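(* Let $n\ge2$, let $\mathcal{M}\subset\mathbb{R}^n$ be a discrete $n$-manifold with vertices $v_1,\dots,v_N$ and measure $\mu$, and let $f:\mathcal{M}\to\mathbb{R}^n$ be an orientation preserving piecewise affine map represented by the matrix $\mathbf{f}\in\mathbb{R}^{N\times n}$ whose $i$-th row is $\mathbf{f}_i=f(v_i)$. Then the discrete volumetric stretch energy functional $E_V(f)=\frac1n\,\mathrm{trace}(\mathbf{f}^\top L_V(f)\,\mathbf{f})$ can be formulated as $$E_V(f)=\sum_{\sigma\in\mathbb{S}_n(\mathcal{M})}\frac{|f(\sigma)|^2}{\mu(\sigma)}.$$
   Context: A discrete $n$-manifold $\mathcal{M}$ in $\mathbb{R}^n$ is a finite simplicial $n$-complex (a union of nondegenerate $n$-simplices, any two of which are disjoint or intersect in a common facet of some dimension) that is topologically equivalent to the closed unit ball $\mathbb{B}^n$. $\mathbb{S}_k(\mathcal{M})$ is its set of $k$-simplices. The measure is $\mu(\sigma)=\rho(\sigma)|\sigma|$ for $\sigma\in\mathbb{S}_n(\mathcal{M})$, with a positive density $\rho$ that is constant on each $n$-simplex. A piecewise affine map is a continuous map on $\mathcal{M}$ that is affine on every $n$-simplex; it is orientation preserving if it preserves the orientation of every $n$-simplex (so no image simplex is degenerate) and $f(\mathcal{M})$ is again a simplicial $n$-complex. The stretch factor of $\sigma\in\mathbb{S}_n(\mathcal{M})$ is $\sigma_{\mu,f^{-1}}(\sigma)=\frac{\mu(\sigma)}{|f(\sigma)|}$. The volumetric stretch Laplacian matrix $L_V(f)\in\mathbb{R}^{N\times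 N}$ is $$[L_V(f)]_{ij}=\begin{cases}-w_{ij}(f),&\text{if }[v_i,v_j]\in\mathbb{S}_1(\mathcal{M}),\\ \sum_{\ell\ne i}w_{i\ell}(f),&\text{if } i=j,\\ 0,&\text{otherwise,}\end{cases}\qquad w_{ij}(f)=\frac{1}{n(n-1)}\sum_{\sigma\in\mathbb{S}_n(\mathcal{M}):\{v_i,v_j\}\subset\sigma}\frac{|f(\sigma_{\hat i\hat j})|}{\sigma_{\mu,f^{-1}}(\sigma)}\cot\theta_{ij}^\sigma(f),$$ where $w_{i\ell}(f)=0$ if $[v_i,v_\ell]\notin\mathbb{S}_1(\mathcal{M})$; $\sigma_{\hat i\hat j}$ is the $(n-2)$-simplex spanned by the vertices of $\sigma$ other than $v_i,v_j$; $|\cdot|$ denotes volume of the appropriate dimension (a $0$-simplex has volume $1$); and $\theta_{ij}^\sigma(f)\in(0,\pi)$ is the (interior) dihedral angle of the simplex $f(\sigma)$ between the facet spanned by its vertices other than $\mathbf{f}_i$ and the facet spanned by its vertices other than $\mathbf{f}_j$. *)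

(* Defs.v *)
From HB Require Import structures.
From mathcomp Require Import all_boot all_order all_algebra.
From mathcomp Require Import all_classical all_reals all_analysis.

Set Implicit Arguments.
Unset Strict Implicit.
Unset Printing Implicit Defensive.

Import Order.TTheory GRing.Theory Num.Theory.
Import numFieldNormedType.Exports.

Local Open Scope classical_set_scope.
Local Open Scope ring_scope.

(* Points of R^n are row vectors.  The library norm on 'rV_n is the sup norm,
   so the Euclidean structure is spelled out; the topology is the same. *)
Section Euclidean.
Variables (R : realType) (n : nat).
Implicit Types u v : 'rV[R]_n.

Definition dot u v : R := \sum_(i < n) u 0 i * v 0 i.

Definition enorm u : R := Num.sqrt (dot u u).

Definition angle u v : R := acos (dot u v / (enorm u * enorm v)).

Definition cot (x : R) : R := cos x / sin x.

Definition unit_ball : set 'rV[R]_n := [set x | enorm x <= 1].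

Definition homeomorphic (A B : set 'rV[R]_n) : Prop :=
  exists g h : 'rV[R]_n -> 'rV[R]_n,
    [/\ {within A, continuous g}, {within B, continuous h},
        set_bij A B g & forall x, A x -> h (g x) = x].

End Euclidean.

(* A list of N points of R^n is the matrix p whose i-th row is the i-th point,
   and a simplex on these points is given by the set A of indices of its
   vertices. *)
Section Simplices.
Variables (R : realType) (n N : nat).
Implicit Types (p : 'M[R]_(N, n)) (A s : {set 'I_N}).

Definition hull p A : set 'rV[R]_n :=
  [set x | exists a : 'I_N -> R,
     [/\ forall i, 0 <= a i, \sum_(i in A) a i = 1
       & x = \sum_(i in A) a i *: row i p]].

Definition points p A : seq 'rV[R]_n := [seq row i p | i <- enum A].

(* The edge vectors issued from the first vertex; meaningful for
   #|A| = k + 1. *)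
Definition edge_mx k p A : 'M[R]_(k, n) :=
  \matrix_(i < k) ((points p A)`_i.+1 - (points p A)`_0).

(* k-dimensional volume of a k-simplex in R^n (Gram determinant); a 0-simplex
   has volume 1. *)
Definition vol k p A : R :=
  Num.sqrt (\det (edge_mx k p A *m (edge_mx k p A)^T)) / (k`!)%:R.

(* Sign of the orientation of an n-simplex of R^n, for the ordering of its
   vertices by increasing index. *)
Definition orientation p A : R := Num.sg (\det (edge_mx n p A)).

(* The component orthogonal to the affine hull of the points in A of the
   vector going from A to x; [kermx W^T] is the orthogonal complement of the
   row space of W. *)
Definition height k p A (x : 'rV[R]_n) : 'rV[R]_n :=
  let W := edge_mx k p A in
  (x - (points p A)`_0) *m proj_mx (kermx W^T) <<W>>%MS.

(* Interior dihedral angle of the n-simplex s between the facets opposite to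
   i and to j.  These facets lie in the two half-hyperplanes bounded by the
   affine hull of the ridge s \ {i, j} that contain j and i respectively. *)
Definition dihedral p s (i j : 'I_N) : R :=
  let ridge := s :\ i :\ j in
  angle (height n.-2 p ridge (row j p)) (height n.-2 p ridge (row i p)).

End Simplices.

Section Complexes.
Variables (R : realType) (n N : nat).
Implicit Types (p : 'M[R]_(N, n)) (S : {set {set 'I_N}}).

Definition disjoint_or_common_face p (s t : {set 'I_N}) : Prop :=
  hull p s `&` hull p t = set0 \/
  exists A B : {set 'I_N},
    [/\ A \subset s, B \subset t, hull p s `&` hull p t = hull p A
      & hull p s `&` hull p t = hull p B].

(* S is the set of top-dimensional simplices.  Distinct indices are not
   required to carry distinct points. *)
Definition simplicial_complex p S : Prop :=
  [/\ forall s, s \in S -> #|s| = n.+1,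
      forall s, s \in S -> row_free (edge_mx n p s)
    & forall s t, s \in S -> t \in S -> disjoint_or_common_face p s t].

Definition carrier p S : set 'rV[R]_n := \bigcup_(s in [set` S]) hull p s.

End Complexes.

Record discrete_manifold (R : realType) (n N : nat) := DiscreteManifold {
  vert : 'M[R]_(N, n);
  top : {set {set 'I_N}};
  vert_inj : injective (fun i => row i vert);
  vert_cover : forall i, exists2 s, s \in top & i \in s;
  top_complex : simplicial_complex vert top;
  carrier_ball : homeomorphic (carrier vert top) (@unit_ball R n)
}.

Section StretchEnergy.
Variables (R : realType) (n N : nat) (M : discrete_manifold R n N).
Implicit Types (rho : {set 'I_N} -> R) (f : 'rV[R]_n -> 'rV[R]_n).
Implicit Types (s : {set 'I_N}) (i j : 'I_N).

Definition simplices (k : nat) : {set {set 'I_N}} :=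
  [set A : {set 'I_N} | (#|A| == k.+1) && [exists s in top M, A \subset s]].

Definition mu rho s : R := rho s * vol n (vert M) s.

(* The matrix representing f, with rows f(v_i). *)
Definition fmx f : 'M[R]_(N, n) := \matrix_(i < N) f (row i (vert M)).

(* Only the restriction of f to the carrier of M is relevant. *)
Definition piecewise_affine f : Prop :=
  {within carrier (vert M) (top M), continuous f} /\
  forall s, s \in simplices n ->
    exists (B : 'M[R]_n) (c : 'rV[R]_n),
      forall x, hull (vert M) s x -> f x = x *m B + c.

Definition orientation_preserving f : Prop :=
  (forall s, s \in simplices n ->
     orientation (fmx f) s = orientation (vert M) s) /\
  simplicial_complex (fmx f) (simplices n).

Definition stretch_factor rho f s : R := mu rho s / vol n (fmx f) s.

Definition weight rho f i j : R :=
  if [set i; j]%SET \in simplices 1 then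
    (n * (n - 1))%:R^-1 *
    \sum_(s in simplices n | [set i; j]%SET \subset s)
      vol n.-2 (fmx f) (s :\ i :\ j) / stretch_factor rho f s *
      cot (dihedral (fmx f) s i j)
  else 0.

Definition laplacian rho f : 'M[R]_N :=
  \matrix_(i, j)
    if [set i; j]%SET \in simplices 1 then - weight rho f i j
    else if i == j then \sum_(l < N | l != i) weight rho f i l
    else 0.

Definition stretch_energy rho f : R :=
  n%:R^-1 * \tr ((fmx f)^T *m laplacian rho f *m fmx f).

End StretchEnergy.

(* Main.v *)
(* Let g_i be the gradient of the barycentric coordinate of the vertex q_i of a
   nondegenerate n-simplex. The ridge opposite to q_i and q_j is orthogonal to
   the plane spanned by g_i and g_j, in which (g_i, g_j) is dual to the basis of
   heights of q_i and q_j over the ridge; inverting the 2x2 Gram matrix of the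
   heights gives |ridge| cot(theta_ij) = - n (n - 1) |simplex| g_i.g_j.
   From sum_i g_i = 0 and sum_i g_i^T q_i = Id one gets
   sum_(i,j) g_i.g_j |q_i - q_j|^2 = - 2 n, so that each simplex contributes
   |f(sigma)|^2 / mu(sigma) to the Laplacian quadratic form. *)

Require Import Defs.
From mathcomp Require Import all_boot all_order all_fingroup all_algebra.
From mathcomp Require Import all_classical all_reals all_analysis.
From mathcomp Require Import ring lra.

Set Implicit Arguments.
Unset Strict Implicit.
Unset Printing Implicit Defensive.

Import Order.TTheory GRing.Theory Num.Theory.

Local Open Scope ring_scope.

(** * Euclidean inner product and orthogonal decomposition *)

Lemma dotE (R : realType) n (u v : 'rV[R]_n) : dot u v = (u *m v^T) 0 0.
Proof. by rewrite mxE; apply: eq_bigr => i _; rewrite mxE. Qed.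

Lemma dotC (R : realType) n (u v : 'rV[R]_n) : dot u v = dot v u.
Proof. by apply: eq_bigr => i _; rewrite mulrC. Qed.

Lemma dotDl (R : realType) n (u v w : 'rV[R]_n) :
  dot (u + v) w = dot u w + dot v w.
Proof. by rewrite !dotE mulmxDl mxE. Qed.

Lemma dotZl (R : realType) n a (u v : 'rV[R]_n) : dot (a *: u) v = a * dot u v.
Proof. by rewrite !dotE -scalemxAl mxE. Qed.

Lemma dotBl (R : realType) n (u v w : 'rV[R]_n) :
  dot (u - v) w = dot u w - dot v w.
Proof. by rewrite dotDl -scaleN1r dotZl mulN1r. Qed.

Lemma dotBr (R : realType) n (u v w : 'rV[R]_n) :
  dot u (v - w) = dot u v - dot u w.
Proof. by rewrite !(dotC u) dotBl. Qed.

Lemma dotDr (R : realType) n (u v w : 'rV[R]_n) :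
  dot u (v + w) = dot u v + dot u w.
Proof. by rewrite !(dotC u) dotDl. Qed.

Lemma dotZr (R : realType) n a (u v : 'rV[R]_n) : dot u (a *: v) = a * dot u v.
Proof. by rewrite !(dotC u) dotZl. Qed.

Lemma dot0l (R : realType) n (v : 'rV[R]_n) : dot 0 v = 0.
Proof. by rewrite dotE mul0mx mxE. Qed.

Lemma dot_suml (R : realType) n (I : finType) (P : pred I) (u : I -> 'rV[R]_n)
    (v : 'rV[R]_n) :
  dot (\sum_(i | P i) u i) v = \sum_(i | P i) dot (u i) v.
Proof.
by rewrite dotE mulmx_suml summxE; apply: eq_bigr => i _; rewrite dotE.
Qed.

Lemma dot_mul_tr0 (R : realType) n k (W : 'M[R]_(k, n)) (u : 'rV[R]_n)
    (c : 'rV[R]_k) :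
  u *m W^T = 0 -> dot u (c *m W) = 0.
Proof. by move=> uW; rewrite dotE trmx_mul mulmxA uW mul0mx mxE. Qed.

Lemma dot_ge0 (R : realType) n (u : 'rV[R]_n) : 0 <= dot u u.
Proof. by apply: sumr_ge0 => i _; apply: sqr_ge0. Qed.

Lemma dot_eq0 (R : realType) n (u : 'rV[R]_n) : dot u u = 0 -> u = 0.
Proof.
move=> u0; apply/rowP => i; rewrite mxE.
have /eqP := @psumr_eq0P R _ predT _ (fun i _ => sqr_ge0 (u 0 i)) u0 i isT.
by rewrite sqrf_eq0 => /eqP.
Qed.

(** A vector lying both in the row space of [W] and in [kermx W^T] is orthogonal to itself, hence
    zero; the ranks add up to [n], so the two subspaces are complementary and [proj_mx] splits [a]
    along them. *)
Lemma orthogonal_component (R : realType) k n (W : 'M[R]_(k, n))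
    (a : 'rV[R]_n) (h := a *m proj_mx (kermx W^T) <<W>>%MS) :
  h *m W^T = 0 /\ exists c, a = h + c *m W.
Proof.
have hW : h *m W^T = 0 by apply/sub_kermxP/proj_mx_sub.
split=> //.
have dir : (kermx W^T :&: <<W>> = 0)%MS.
  apply/eqP/rowV0P => v; rewrite sub_capmx genmxE => /andP[/sub_kermxP vW].
  case/submxP => d v_def; apply: dot_eq0.
  by rewrite {2}v_def dot_mul_tr0.
have full : (a <= kermx W^T + <<W>>)%MS.
  apply: submx_full; rewrite /row_full mxrank_disjoint_sum // mxrank_ker.
  by rewrite mxrank_tr genmxE subnK // rank_leq_col.
have := @proj_mx_sub _ _ _ <<W>>%MS (kermx W^T) a.
rewrite genmxE => /submxP[c c_def].
by exists c; rewrite -c_def /h add_proj_mx.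
Qed.

(** * Edge matrices and gradients of barycentric coordinates *)

(** Analogue of [edge_mx] for a family of points in any order, free from the increasing enumeration
    of an index set. *)
Definition edges (R : realType) n k (x : 'I_k.+1 -> 'rV[R]_n) : 'M[R]_(k, n) :=
  \matrix_(i < k) (x (lift ord0 i) - x ord0).

(* Unlike [edges], this bordered matrix does not single out a base vertex, so
   reordering the vertices just permutes its rows. *)
Definition homog (R : realType) n (x : 'I_n.+1 -> 'rV[R]_n) : 'M[R]_(1 + n) :=
  row_mx (const_mx 1) (\matrix_(i < n.+1) x i).

(** Row reduction: subtracting the first row of [homog x] from the others leaves a block triangular
    matrix with diagonal blocks 1 and [edges x]. *)
Lemma det_homog (R : realType) n (x : 'I_n.+1 -> 'rV[R]_n) :
  \det (homog x) = \det (edges x).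
Proof.
have -> : homog x = block_mx 1%:M 0 (const_mx 1) 1%:M
                    *m block_mx 1%:M (x ord0) 0 (edges x).
  rewrite mulmx_block !mul1mx !mul0mx mulmx1 !addr0 /homog block_mxEh.
  congr row_mx.
    apply/matrixP => i j; rewrite ord1 [RHS]mxE.
    by case: splitP => l _; rewrite !mxE // ord1.
  apply/matrixP => i j; rewrite [RHS]mxE [LHS]mxE.
  case: splitP => l li.
    by rewrite ord1 in li *; congr (x _ _ _); apply/val_inj.
  rewrite !mxE big_ord1 !mxE mul1r addrC subrK.
  by congr (x _ _ _); apply/val_inj.
by rewrite det_mulmx det_lblock det_ublock !det1 !mul1r.
Qed.

Lemma normr_det_edges_perm (R : realType) n (x : 'I_n.+1 -> 'rV[R]_n)
    (s : 'S_n.+1) :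
  `|\det (edges (x \o s))| = `|\det (edges x)|.
Proof.
rewrite -!det_homog.
have -> : homog (x \o s) = row_perm s (homog x).
  apply/matrixP => i j; rewrite !mxE.
  by case: splitP => l _; rewrite !mxE.
by rewrite row_permE det_mulmx det_perm normrM normrX normrN1 expr1n mul1r.
Qed.

(** Column [i] of the inverse of [homog x] lists the coefficients of the barycentric coordinate of
    [x i]: the constant term on top, the gradient [g i] below. The left inverse identity yields the
    two sums, the right one the values of the coordinates at the vertices. *)
Lemma barycentric_gradients (R : realType) n (x : 'I_n.+1 -> 'rV[R]_n) :
  edges x \in unitmx ->
  exists g : 'I_n.+1 -> 'rV[R]_n,
    [/\ \sum_i g i = 0, \sum_i (g i)^T *m x i = 1%:M
      & forall i j k, dot (g i) (x j - x k) = (i == j)%:R - (i == k)%:R].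
Proof.
move=> x_unit.
have H_unit : homog x \in unitmx by rewrite unitmxE det_homog -unitmxE.
pose G : 'M[R]_(1 + n) := invmx (homog x).
pose g (i : 'I_n.+1) : 'rV[R]_n := (col i (dsubmx G))^T.
have GH : dsubmx G *m homog x = row_mx 0 1%:M.
  have := mulVmx H_unit.
  rewrite -/G -{1}[G]vsubmxK mul_col_mx -[1%:M]vsubmxK => /eq_col_mx[_ ->].
  by rewrite (@scalar_mx_block _ 1 n 1) /block_mx col_mxKd.
have HG : homog x *m G = 1%:M by exact: mulmxV.
move: GH; rewrite mul_mx_row => /eq_row_mx[G1 Gx].
exists g; split.
- apply/rowP => a; rewrite summxE [RHS]mxE.
  have /matrixP/(_ a 0) := G1; rewrite !mxE => G1a; rewrite -[RHS]G1a.
  by apply: eq_bigr => i _; rewrite !mxE mulr1.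
- rewrite -Gx; apply/matrixP => a b; rewrite summxE !mxE.
  by apply: eq_bigr => i _; rewrite !mxE big_ord1 !mxE.
have HGE i j : usubmx G 0 i + dot (x j) (g i) = (j == i)%:R.
  have /matrixP/(_ j i) := HG.
  rewrite -{1}[G]vsubmxK mul_row_col !mxE big_ord1 !mxE mul1r => <-.
  by congr (_ + _); apply: eq_bigr => l _; rewrite !mxE.
move=> i j k; rewrite dotC dotBl !(eq_sym i) -!HGE; ring.
Qed.

(** * Gram determinants and cotangents of angles *)

Lemma det_block22 (R : comPzRingType) (a b c d : 'M[R]_1) :
  \det (block_mx a b c d) = a 0 0 * d 0 0 - b 0 0 * c 0 0.
Proof.
rewrite (expand_det_row _ (lshift 1 0)) big_split_ord !big_ord1.
rewrite block_mxEul block_mxEur /cofactor !det_mx11 /= expr0 expr1 mul1r mulN1r.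
rewrite mulrN.
set A := block_mx a b c d.
have -> : row' (lshift 1 0) (col' (lshift 1 0) A) 0 0 = d 0 0.
  rewrite -(block_mxEdr a b c d) -/A mxE mxE.
  by congr (A _ _); apply/val_inj.
have -> // : row' (lshift 1 0) (col' (rshift 1 0) A) 0 0 = c 0 0.
rewrite -(block_mxEdl a b c d) -/A mxE mxE.
by congr (A _ _); apply/val_inj.
Qed.

Lemma det_gram2 (R : realType) n (u v : 'rV[R]_n)
    (H := col_mx u v : 'M[R]_(1 + 1, n)) :
  \det (H *m H^T) = dot u u * dot v v - dot u v ^+ 2.
Proof.
rewrite /H tr_col_mx mul_col_row det_block22 -!dotE.
by rewrite (dotC v u) expr2.
Qed.

(** Multiplied by [dot v v], the difference becomes the squared norm of
    [dot v v *: u - dot u v *: v]. *)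
Lemma dot_CS (R : realType) n (u v : 'rV[R]_n) :
  0 <= dot u u * dot v v - dot u v ^+ 2.
Proof.
have [v0|v0] := eqVneq (dot v v) 0.
  by rewrite (dot_eq0 v0) (dotC u) !dot0l mulr0 expr0n subr0.
have vv : 0 < dot v v by rewrite lt_def v0 dot_ge0.
rewrite -(pmulr_rge0 _ vv).
have := dot_ge0 (dot v v *: u - dot u v *: v).
suff -> : dot (dot v v *: u - dot u v *: v) (dot v v *: u - dot u v *: v) =
  dot v v * (dot u u * dot v v - dot u v ^+ 2) by [].
by rewrite dotBl !dotBr !dotZl !dotZr (dotC v u); ring.
Qed.

(** With [c] the cosine, [D] is [1 - c ^+ 2] times the squared product of the norms, so its root is
    that product times the sine. Positivity of [D] makes both vectors nonzero and puts [c] in the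
    range where [acos] inverts the cosine. *)
Lemma cot_angle (R : realType) n (u v : 'rV[R]_n)
    (D := dot u u * dot v v - dot u v ^+ 2) :
  0 < D -> cot (angle u v) = dot u v / Num.sqrt D.
Proof.
move=> D_gt0; set c := dot u v / (enorm u * enorm v).
have uv_gt0 : 0 < dot u u * dot v v.
  by rewrite (lt_le_trans D_gt0) // /D lerBlDr lerDl sqr_ge0.
have nE : (enorm u * enorm v) ^+ 2 = dot u u * dot v v.
  by rewrite exprMn !sqr_sqrtr ?dot_ge0.
have n_gt0 : 0 < enorm u * enorm v.
  rewrite lt_def mulr_ge0 ?sqrtr_ge0 // andbT; apply: contraTneq uv_gt0 => n0.
  by rewrite -nE n0 expr0n ltxx.
have DE : D = (1 - c ^+ 2) * (enorm u * enorm v) ^+ 2.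
  by rewrite mulrBl mul1r -exprMn /c divfK ?gt_eqF // nE.
have c2 : 0 < 1 - c ^+ 2.
  by move: D_gt0; rewrite DE pmulr_lgt0 // exprn_gt0.
have c1 : -1 <= c <= 1.
  by rewrite -ler_norml -(@ler_pXn2r _ 2) ?nnegrE // real_normK ?num_real //; lra.
rewrite /cot /angle -/c acosK ?in_itv // sin_acos // DE sqrtrM ?ltW //.
by rewrite sqrtr_sqr gtr0_norm // invfM [RHS]mulrA mulrAC.
Qed.

(** Here [W] is the edge matrix of a ridge, [ha] and [hb] are heights over it, and [ga], [gb] form
    the dual pair in the plane orthogonal to it. Both sides reduce to [dot ha hb] through the Gram
    determinant [D] of the heights. *)
Lemma cot_angle_dual (R : realType) n k (W : 'M[R]_(k, n))
    (a b ha hb ga gb : 'rV[R]_n) (ca cb : 'rV[R]_k)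
    (F := col_mx (col_mx a b) W : 'M[R]_(1 + 1 + k, n)) :
    (forall v : 'rV[R]_n, v *m F^T = 0 -> v = 0) -> \det (F *m F^T) != 0 ->
    ha *m W^T = 0 -> hb *m W^T = 0 -> a = ha + ca *m W -> b = hb + cb *m W ->
    ga *m W^T = 0 -> gb *m W^T = 0 ->
    dot ga a = 1 -> dot ga b = 0 -> dot gb a = 0 -> dot gb b = 1 ->
  Num.sqrt (\det (W *m W^T)) * cot (angle ha hb) =
  - (Num.sqrt (\det (F *m F^T)) * dot ga gb).
Proof.
move=> F_full F_nz haW hbW aE bE gaW gbW gaa gab gba gbb.
pose D := dot ha ha * dot hb hb - dot ha hb ^+ 2.
(* Replacing [a] and [b] by their heights is a unipotent row operation, and the heights are
   orthogonal to [W], so the Gram matrix becomes block diagonal. *)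
have detF : \det (F *m F^T) = D * \det (W *m W^T).
  have -> : F = block_mx 1%:M (col_mx ca cb) 0 1%:M
                  *m col_mx (col_mx ha hb) W.
    rewrite mul_block_col !mul1mx mul0mx add0r mul_col_mx.
    by rewrite add_col_mx -aE -bE.
  rewrite trmx_mul mulmxA -(mulmxA (block_mx _ _ _ _)) !det_mulmx.
  rewrite det_tr det_ublock !det1 !mul1r.
  have HW : col_mx ha hb *m W^T = 0 by rewrite mul_col_mx haW hbW col_mx0.
  rewrite mulr1 (tr_col_mx _ W) mul_col_row HW.
  by rewrite det_lblock det_gram2.
have D_gt0 : 0 < D.
  rewrite lt_def dot_CS andbT; apply: contraNneq F_nz => D0.
  by rewrite detF D0 mul0r.
have orth u c : u *m W^T = 0 -> dot u (c *m W) = 0 by exact: dot_mul_tr0.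
have gaha : dot ga ha = 1 by rewrite -gaa aE dotDr orth ?addr0.
have gbha : dot gb ha = 0 by rewrite -gba aE dotDr orth ?addr0.
have gbhb : dot gb hb = 1 by rewrite -gbb bE dotDr orth ?addr0.
(* The coefficients are a row of the inverse of the 2x2 Gram matrix of the heights. The difference
   of the two sides is orthogonal to every row of [F], so [F_full] kills it. *)
have gE : ga = D^-1 *: (dot hb hb *: ha - dot ha hb *: hb).
  apply/eqP; rewrite -subr_eq0; apply/eqP/F_full.
  have D0 : D != 0 by rewrite gt_eqF.
  rewrite !tr_col_mx !mul_mx_row.
  set v := ga - _.
  have va : dot v a = 0.
    rewrite dotBl gaa dotZl dotBl !dotZl aE !dotDr !orth // !addr0.
    by rewrite (dotC hb ha) /D; field.
  have vb : dot v b = 0.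
    rewrite dotBl gab dotZl dotBl !dotZl bE !dotDr !orth // !addr0.
    by rewrite /D; field.
  have -> : v *m W^T = 0.
    by rewrite mulmxBl gaW -scalemxAl mulmxBl -!scalemxAl haW hbW !scaler0 subr0
      scaler0 subr0.
  have -> : v *m a^T = 0 by apply/matrixP => x y; rewrite !ord1 -dotE va mxE.
  have -> : v *m b^T = 0 by apply/matrixP => x y; rewrite !ord1 -dotE vb mxE.
  by rewrite !row_mx0.
have -> : dot ga gb = - dot ha hb / Num.sqrt D ^+ 2.
  rewrite sqr_sqrtr ?ltW // gE dotZl dotBl !dotZl !(dotC _ gb) gbha gbhb; ring.
rewrite cot_angle // -/D detF sqrtrM ?ltW //.
by field; rewrite sqrtr_eq0 -ltNge.
Qed.

(** * Volumes, ridges and gradients of indexed simplices *)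

Lemma edge_mxE (R : realType) n N k (p : 'M[R]_(N, n)) (A : {set 'I_N}) i0 :
  #|A| = k.+1 ->
  edge_mx k p A = edges (fun a : 'I_k.+1 => row (nth i0 (enum A) a) p).
Proof.
move=> A_card; apply/row_matrixP => a; rewrite !rowK /points.
by rewrite !(nth_map i0) // -cardE A_card // ltnS.
Qed.

Lemma normr_det_edge_mx (R : realType) n N (p : 'M[R]_(N, n)) (s : {set 'I_N})
    (l : seq 'I_N) i0 :
  #|s| = n.+1 -> perm_eq l (enum s) ->
  `|\det (edges (fun a : 'I_n.+1 => row (nth i0 l a) p))| =
  `|\det (edge_mx n p s)|.
Proof.
move=> s_card l_perm.
have s_size : size (enum s) == n.+1 by rewrite -cardE s_card.
have /tuple_permP[sg lE] : perm_eq l (Tuple s_size) by [].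
rewrite (edge_mxE p i0 s_card) -[RHS](normr_det_edges_perm _ sg).
have lnth (b : 'I_n.+1) : nth i0 l b = nth i0 (enum s) (sg b).
  by rewrite lE -tnth_nth tnth_mktuple (tnth_nth i0).
by congr `|\det _|; apply/row_matrixP => a; rewrite !rowK !lnth.
Qed.

Lemma vol_top (R : realType) n N (p : 'M[R]_(N, n)) (s : {set 'I_N}) :
  vol n p s = `|\det (edge_mx n p s)| / n`!%:R.
Proof. by rewrite /vol det_mulmx det_tr -expr2 sqrtr_sqr. Qed.

(** The vertices are reordered so that the edge matrix of [s] consists of the edges to [j] and [i]
    stacked on that of the ridge, which is the setting of [cot_angle_dual]. *)
Lemma ridge_cot (R : realType) k N (p : 'M[R]_(N, k.+2)) (s : {set 'I_N})
    (g : 'I_N -> 'rV[R]_k.+2) i j :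
    #|s| = k.+3 -> edge_mx k.+2 p s \in unitmx -> i \in s -> j \in s -> i != j ->
    (forall a b c, a \in s -> b \in s -> c \in s ->
       dot (g a) (row b p - row c p) = (a == b)%:R - (a == c)%:R) ->
  vol k p (s :\ i :\ j) * cot (dihedral p s i j) =
  - ((k.+2 * k.+1)%:R * vol k.+2 p s * dot (g i) (g j)).
Proof.
move=> s_card s_unit si sj ij gP; set r := s :\ i :\ j.
have r_card : #|r| = k.+1.
  have := cardsD1 i s; rewrite si s_card (cardsD1 j) !inE (eq_sym j) ij sj.
  by rewrite !add1n => -[->].
pose w0 := nth i (enum r) 0.
have mem_r a : (a < k.+1)%N -> nth i (enum r) a \in r.
  by move=> lt_a; rewrite -mem_enum mem_nth // -cardE r_card.
have rs a : a \in r -> [/\ a \in s, a != i & a != j].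
  by rewrite !inE => /and3P[].
(* The list starts at [w0], the base vertex of [edge_mx k p r], so that all edges issue from the
   same point. *)
pose l := [:: w0, j, i & behead (enum r)].
have rE : enum r = w0 :: behead (enum r).
  by rewrite /w0; have := r_card; rewrite cardE; case: (enum r).
have l_perm : perm_eq l (enum s).
  have lr : perm_eq l [:: j, i & enum r].
    by rewrite rE (perm_catCA [:: w0] [:: j; i]).
  apply: perm_trans lr (uniq_perm _ (enum_uniq _) _).
    rewrite /= enum_uniq !inE !mem_enum !inE !eqxx (eq_sym j) (negPf ij).
    by rewrite !andbF.
  move=> a; rewrite !inE !mem_enum !inE.
  have [->|_] := eqVneq a j; first by rewrite sj.
  by have [->|_] := eqVneq a i; rewrite ?si.
pose W := edge_mx k p r.
have W0 : (points p r)`_0 = row w0 p.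
  by rewrite /points (nth_map i) // -cardE r_card.
have [haW [cj ajE]] := orthogonal_component W (row j p - row w0 p).
have [hbW [ci aiE]] := orthogonal_component W (row i p - row w0 p).
(* The barycentric coordinate of a vertex off the ridge vanishes on the ridge, so its gradient is
   orthogonal to the ridge edges. *)
have gW a : a \in s -> a \notin r -> g a *m W^T = 0.
  move=> sa ra; apply/rowP => b; rewrite [RHS]mxE.
  have -> : (g a *m W^T) 0 b = dot (g a) (row b W).
    by rewrite dotE !mxE; apply: eq_bigr => c _; rewrite !mxE.
  rewrite /W (edge_mxE p i r_card) rowK.
  have rb := mem_r (lift ord0 b) (ltn_ord _); have r0 := mem_r 0 isT.
  have [sb _ _] := rs _ rb; have [s0 _ _] := rs _ r0.
  have na c : c \in r -> (a == c) = false.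
    by move=> rc; apply: contraNF ra => /eqP->.
  by rewrite gP // !na // subr0.
(* F is square, since 1 + 1 + k is convertible to k.+2. *)
pose F : 'M[R]_(1 + 1 + k, k.+2) :=
  col_mx (col_mx (row j p - row w0 p) (row i p - row w0 p)) W.
have FE : F = edges (fun a : 'I_k.+3 => row (nth i l a) p).
  apply/matrixP => a c; rewrite [RHS]mxE.
  case: (split_ordP a) => b ->; rewrite ?col_mxEu ?col_mxEd.
    by case: (split_ordP b) => e ->; rewrite ord1 ?col_mxEu ?col_mxEd.
  by rewrite /W (edge_mxE p i r_card) [LHS]mxE /= nth_behead.
have detF : `|\det (F : 'M[R]_(k.+2))| = `|\det (edge_mx k.+2 p s)|.
  by rewrite FE (normr_det_edge_mx p i s_card l_perm).
have F_unit : (F : 'M[R]_(k.+2)) \in unitmx.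
  by rewrite unitmxE unitfE -normr_eq0 detF normr_eq0 -unitfE -unitmxE.
have detFF : \det (F *m F^T) = \det (F : 'M[R]_(k.+2)) ^+ 2.
  by rewrite det_mulmx det_tr expr2.
have [s0 w0i w0j] := rs _ (mem_r 0 isT).
have Fv (v : 'rV[R]_k.+2) : v *m F^T = 0 -> v = 0.
  move=> vF; have FT_unit : (F : 'M[R]_(k.+2))^T \in unitmx by rewrite unitmx_tr.
  by rewrite -[v](mulmxK FT_unit) vF mul0mx.
have FF0 : \det (F *m F^T) != 0.
  by rewrite detFF expf_neq0 // -unitfE -unitmxE.
have gjj : dot (g j) (row j p - row w0 p) = 1.
  by rewrite gP // eqxx eq_sym (negPf w0j) subr0.
have gji : dot (g j) (row i p - row w0 p) = 0.
  by rewrite gP // !(eq_sym j) (negPf ij) (negPf w0j) subr0.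
have gij : dot (g i) (row j p - row w0 p) = 0.
  by rewrite gP // (eq_sym _ w0) (negPf ij) (negPf w0i) subr0.
have gii : dot (g i) (row i p - row w0 p) = 1.
  by rewrite gP // eqxx eq_sym (negPf w0i) subr0.
have gjW : g j *m W^T = 0 by apply: gW; rewrite // !inE eqxx.
have giW : g i *m W^T = 0 by apply: gW; rewrite // !inE eqxx andbF.
have := cot_angle_dual Fv FF0 haW hbW ajE aiE gjW giW gjj gji gij gii.
rewrite -/F detFF sqrtr_sqr detF => cotE.
rewrite vol_top /vol /dihedral /height -/r -/W W0 mulrAC cotE dotC.
(* The volumes are normalised by the factorials of [k] and [k.+2], whose ratio is the constant
   [k.+2 * k.+1]. *)
rewrite !factS !natrM; field.
by rewrite -natrD nat1r !pnatr_eq0 -lt0n fact_gt0.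
Qed.

Lemma simplex_gradients (R : realType) n N (p : 'M[R]_(N, n))
    (s : {set 'I_N}) :
  #|s| = n.+1 -> edge_mx n p s \in unitmx ->
  exists g : 'I_N -> 'rV[R]_n,
    [/\ \sum_(i in s) g i = 0, \sum_(i in s) (g i)^T *m row i p = 1%:M
      & forall i j k, i \in s -> j \in s -> k \in s ->
        dot (g i) (row j p - row k p) = (i == j)%:R - (i == k)%:R].
Proof.
move=> s_card s_unit.
have /card_gt0P[i0 _] : (0 < #|s|)%N by rewrite s_card.
pose v (a : 'I_n.+1) := nth i0 (enum s) a.
(* Inverse of [v] on [s]; elsewhere the index is out of range and [inord] returns its default. *)
pose r i : 'I_n.+1 := inord (index i (enum s)).
have s_size : size (enum s) = n.+1 by rewrite -cardE.
have vK : cancel v r.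
  by move=> a; rewrite /r index_uniq ?enum_uniq ?s_size // inord_val.
have rK i : i \in s -> v (r i) = i.
  move=> si; rewrite /v inordK ?nth_index ?mem_enum //.
  by rewrite -s_size index_mem mem_enum.
have sumE (V : nmodType) (G : 'I_N -> V) : \sum_(i in s) G i = \sum_a G (v a).
  by rewrite -big_enum (big_nth i0) s_size big_mkord.
move: s_unit; rewrite (edge_mxE p i0 s_card).
case/barycentric_gradients=> g [g0 gp gP].
exists (g \o r); split.
- by rewrite sumE -[RHS]g0; apply: eq_bigr => a _ /=; rewrite vK.
- by rewrite sumE -[RHS]gp; apply: eq_bigr => a _ /=; rewrite vK.
move=> i j k si sj sk; rewrite -{1}(rK j sj) -{1}(rK k sk) gP.
by rewrite !(inj_in_eq (can_in_inj rK)).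
Qed.

(** * Summation over vertex pairs *)

(** When the squared distances are expanded, the square terms vanish because the gradients sum to
    zero. The cross terms give the trace of the identity, written as the product of
    [\sum_(i in s) (g i)^T *m x i] with its transpose. *)
Lemma gradient_energy (R : realType) n (I : finType) (s : {set I})
    (g x : I -> 'rV[R]_n) :
  \sum_(i in s) g i = 0 -> \sum_(i in s) (g i)^T *m x i = 1%:M ->
  \sum_(i in s) \sum_(j in s) dot (g i) (g j) * dot (x i - x j) (x i - x j) =
  - (2 * n%:R).
Proof.
move=> g0 gx.
have row0 a : \sum_(i in s) \sum_(j in s) dot (g i) (g j) * a i = 0 :> R.
  apply: big1 => i _; rewrite -mulr_suml.
  under eq_bigr do rewrite dotC.
  by rewrite -dot_suml g0 dot0l mul0r.
have cross : \sum_(i in s) \sum_(j in s) dot (g i) (g j) * dot (x i) (x j)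
    = n%:R.
  rewrite -(mxtrace1 R n) -[1%:M]mulmx1 -{2}trmx1 -gx raddf_sum /= mulmx_suml.
  rewrite raddf_sum; apply: eq_bigr => i _; rewrite mulmx_sumr raddf_sum /=.
  apply: eq_bigr => j _; rewrite trmx_mul trmxK mulmxA mxtrace_mulC !mulmxA.
  rewrite -mulmxA (mx11_scalar (x i *m (x j)^T)) mul_mx_scalar.
  by rewrite mxtraceZ /mxtrace big_ord1 -!dotE mulrC (dotC (g j)).
pose G i j := dot (g i) (g j).
transitivity (\sum_(i in s) \sum_(j in s) G i j * dot (x i) (x i)
  + \sum_(i in s) \sum_(j in s) G i j * dot (x j) (x j)
  - 2 * \sum_(i in s) \sum_(j in s) G i j * dot (x i) (x j)).
  rewrite mulr_sumr -sumrN -!big_split; apply: eq_bigr => i _ /=.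
  rewrite mulr_sumr -sumrN -!big_split; apply: eq_bigr => j _ /=.
  rewrite dotBl !dotBr (dotC (x j) (x i)) /G; ring.
rewrite cross row0 add0r exchange_big /=.
under eq_bigr do under eq_bigr do rewrite /G dotC.
by rewrite row0 add0r.
Qed.

(** Cyclicity of the trace gives the sum [S] below; averaging it with its copy under the exchange of
    [i] and [j] completes the squares, whence the factor one half. *)
Lemma laplacian_quadratic_form (R : realType) n N (F : 'M[R]_(N, n))
    (w : 'I_N -> 'I_N -> R) (d := fun i j => row i F - row j F) :
  (forall i j, w i j = w j i) ->
  \tr (F^T *m (\matrix_(i, j) if i == j then \sum_(l | l != i) w i l
                              else - w i j) *m F) =
  2^-1 * \sum_i \sum_(j | j != i) w i j * dot (d i j) (d i j).
Proof.
move=> w_sym; rewrite -mulmxA mxtrace_mulC; set L := \matrix_(i, j) _.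
have FFE i j : (F *m F^T) i j = dot (row i F) (row j F).
  by rewrite mxE; apply: eq_bigr => c _; rewrite !mxE.
pose S := \sum_i \sum_(j | j != i)
  w i j * (dot (row i F) (row i F) - dot (row i F) (row j F)).
have -> : \tr (L *m F *m F^T) = S.
  rewrite -mulmxA /mxtrace; apply: eq_bigr => i _.
  rewrite mxE (bigD1 i) //= FFE mxE eqxx mulr_suml -big_split /=.
  apply: eq_bigr => j ji; rewrite FFE mxE eq_sym (negPf ji).
  by rewrite (dotC (row j F)); ring.
have S_sym : S = \sum_i \sum_(j | j != i)
  w i j * (dot (row j F) (row j F) - dot (row i F) (row j F)).
  rewrite /S (exchange_big_dep predT) //=; apply: eq_bigr => i _.
  apply: eq_big => [j|j _]; first by rewrite eq_sym.
  by rewrite w_sym (dotC (row j F)).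
apply: (@mulfI _ 2); rewrite ?pnatr_eq0 // mulrA divff ?pnatr_eq0 // mul1r.
rewrite mulr_natl mulr2n {1}S_sym -big_split; apply: eq_bigr => i _ /=.
rewrite -big_split; apply: eq_bigr => j _ /=.
by rewrite /d dotBl !dotBr (dotC (row j F)); ring.
Qed.

Lemma cotangent_volume (R : realType) k N (p : 'M[R]_(N, k.+2))
    (s : {set 'I_N}) (d := fun i j => row i p - row j p) :
  #|s| = k.+3 -> edge_mx k.+2 p s \in unitmx ->
  \sum_(i in s) \sum_(j in s | j != i)
    vol k p (s :\ i :\ j) * cot (dihedral p s i j) * dot (d i j) (d i j) =
  2 * k.+2%:R * (k.+2 * k.+1)%:R * vol k.+2 p s.
Proof.
move=> s_card s_unit; have [g [g0 gp gP]] := simplex_gradients s_card s_unit.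
pose c := (k.+2 * k.+1)%:R * vol k.+2 p s.
transitivity (- c * \sum_(i in s) \sum_(j in s)
    dot (g i) (g j) * dot (d i j) (d i j)).
  rewrite mulr_sumr; apply: eq_bigr => i si.
  (* The diagonal terms carry a zero distance, so the sum over all pairs agrees with the sum over
     distinct ones. *)
  rewrite [in RHS](bigD1 i) //= /d subrr dot0l mulr0 add0r.
  rewrite mulr_sumr; apply: eq_bigr => j /andP[sj ji].
  by rewrite (ridge_cot s_card s_unit si sj _ gP) 1?eq_sym // /c; ring.
rewrite (gradient_energy g0 gp) /c; ring.
Qed.

(** * Stretch weights and the energy formula *)

Lemma angleC (R : realType) n (u v : 'rV[R]_n) : angle u v = angle v u.
Proof. by rewrite /angle dotC (mulrC (enorm u)). Qed.

Lemma setD1_swap (T : finType) (s : {set T}) a b : s :\ a :\ b = s :\ b :\ a.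
Proof. by apply/setP => c; rewrite !inE andbCA. Qed.

Lemma dihedralC (R : realType) n N (p : 'M[R]_(N, n)) s i j :
  dihedral p s i j = dihedral p s j i.
Proof. by rewrite /dihedral (setD1_swap s i j) angleC. Qed.

(** If [i] and [j] are not joined by an edge, no simplex contains both, and the empty sum matches
    the value 0 of [weight]. *)
Lemma weightE (R : realType) n N (M : discrete_manifold R n N) rho f i j :
  i != j ->
  weight M rho f i j = (n * (n - 1))%:R^-1 *
    \sum_(s in simplices M n | (i \in s) && (j \in s))
      vol n.-2 (fmx M f) (s :\ i :\ j) / stretch_factor M rho f s *
      cot (dihedral (fmx M f) s i j).
Proof.
move=> ij.
have sub_ij (s : {set 'I_N}) :
    ([set i; j]%SET \subset s) = (i \in s) && (j \in s).
  by rewrite finset.subUset !finset.sub1set.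
rewrite /weight; case: (boolP ([set i; j]%SET \in simplices M 1)) => [_|ij1].
  by under [in RHS]eq_bigl do rewrite -sub_ij.
rewrite big1 ?mulr0 // => s /and3P[+ si sj]; rewrite inE => /andP[_].
case/exists_inP => t tM st; move: ij1; rewrite inE cards2 ij.
case/existsP; exists t; rewrite tM (fintype.subset_trans _ st) //.
by rewrite sub_ij si.
Qed.

Lemma weightC (R : realType) n N (M : discrete_manifold R n N) rho f i j :
  weight M rho f i j = weight M rho f j i.
Proof.
have [->|ij] := eqVneq i j; first by [].
have ji : j != i by rewrite eq_sym.
rewrite (weightE _ _ _ ij) (weightE _ _ _ ji).
apply: (congr1 (fun x => _ * x)).
apply: eq_big => [s|s _]; first by rewrite (andbC (i \in s)).
by rewrite (setD1_swap _ i j) (dihedralC _ _ i j).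
Qed.

Theorem theorem3 (R : realType) (n N : nat) (hn : (2 <= n)%N)
  (M : discrete_manifold R n N)
  (rho : {set 'I_N} -> R) (hrho : forall s, s \in simplices M n -> 0 < rho s)
  (f : 'rV[R]_n -> 'rV[R]_n)
  (hfa : piecewise_affine M f) (hfo : orientation_preserving M f) :
  stretch_energy M rho f =
  \sum_(s in simplices M n) vol n (fmx M f) s ^+ 2 / mu M rho s.
Proof.
case: hfo => _ [s_card s_free _] {hfa hrho}.
(* Writing [n] as [k.+2] makes the ridge dimension [n.-2] compute to [k]. *)
case: n hn M f s_card s_free => [|[|k]] // _ M f s_card s_free.
set p := fmx M f; pose w := weight M rho f.
have w_sym i j : w i j = w j i by exact: weightC.
have -> : stretch_energy M rho f = k.+2%:R^-1 *
    (2^-1 * \sum_i \sum_(j | j != i)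
      w i j * dot (row i p - row j p) (row i p - row j p)).
  rewrite /stretch_energy -laplacian_quadratic_form //.
  congr (_ * \tr (_ *m _ *m _)); apply/matrixP => i j; rewrite !mxE.
  (* [laplacian] tests for an edge before the diagonal; for [i = j] the pair is a singleton, hence
     not an edge. *)
  have [<-|ij] := eqVneq i j; first by rewrite finset.setUid inE cards1.
  by rewrite /w /weight; case: (_ \in simplices _ _); rewrite ?oppr0.
pose X s i j := vol k p (s :\ i :\ j) * cot (dihedral p s i j)
  * dot (row i p - row j p) (row i p - row j p).
have wE i j : j != i ->
    w i j * dot (row i p - row j p) (row i p - row j p) =
    (k.+2 * k.+1)%:R^-1 * \sum_(s in simplices M k.+2 | (i \in s) && (j \in s))
      (stretch_factor M rho f s)^-1 * X s i j.
  move=> ji; rewrite /w weightE 1?eq_sym //.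
  rewrite -mulrA mulr_suml subn1; congr (_ * _).
  by apply: eq_bigr => s _; rewrite /X -/p; ring.
(* Exchange of summations: pairs of vertices with the simplices containing them become simplices
   with their pairs of vertices. *)
have -> : \sum_i \sum_(j | j != i)
      w i j * dot (row i p - row j p) (row i p - row j p) =
    (k.+2 * k.+1)%:R^-1 * \sum_(s in simplices M k.+2)
      (stretch_factor M rho f s)^-1 *
      \sum_(i in s) \sum_(j in s | j != i) X s i j.
  under eq_bigr do under eq_bigr do rewrite wE //.
  under eq_bigr do rewrite -mulr_sumr.
  rewrite -mulr_sumr; congr (_ * _).
  under [RHS]eq_bigr do rewrite mulr_sumr.
  rewrite [RHS](exchange_big_dep predT) //=; apply: eq_bigr => i _.
  under [RHS]eq_bigr do rewrite mulr_sumr.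
  rewrite [RHS](exchange_big_dep (fun j => j != i)) /=; last first.
    by move=> s j _ /andP[].
  apply: eq_bigr => j ji; apply: eq_bigl => s.
  by rewrite ji andbT andbA.
rewrite !mulr_sumr; apply: eq_bigr => s sS.
have s_unit : edge_mx k.+2 p s \in unitmx by rewrite -row_free_unit s_free.
(* The inverse stretch factor supplies the second power of the volume, and the three numerical
   prefactors cancel the constant of [cotangent_volume]. *)
rewrite cotangent_volume ?s_card // /stretch_factor invf_div.
move: (mu M rho s)^-1 => c; field.
by rewrite -natrD nat1r !pnatr_eq0.
Qed.
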